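(* Let $\mathbb{F}$ be a field of characteristic $2$. Let $\widetilde\Gamma$ be the lift of $\widetilde H_3(\mathbb{F})$ with respect to the voltage assignment $\ell^U$, and let $\Gamma=\widetilde\Gamma/\sim$ be its reduct. Then every connected component of $\Gamma$ is an $|\mathbb{F}^6|$-fold cover of $H_3(\mathbb{F})$.
   Context: All graphs are simple and undirected; $u\perp v$ denotes adjacency, and a dart is an ordered pair $(u,v)$ with $u\perp v$; $D(\Delta)$ is the set of darts of $\Delta$. A voltage assignment of a graph $\Delta$ in a group $N$ is a map $\ell:D(\Delta)\to N$ with $\ell(u,v)=\ell(v,u)^{-1}$; the lift of $\Delta$ with respect to $\ell$ is the graph with vertex set $V(\Delta)\times N$ in which $(u,m)\perp(v,n)$ iff $u\perp v$ and $\ell(u,v)=mn^{-1}$ (written $m-n$ when $N$ is abelian and written additively). The local graph at a vertex is the subgraph induced on its neighbourhood. A map $V(\Gamma)\to V(\Delta)$ preserving adjacency and mapping the local graph at every vertex isomorphically onto the local graph at its image is a local isomorphism; if $\Gamma,\Delta$ are connected and such a map exists, $\Gamma$ is a cover of $\Delta$, and it is a $k$-fold cover if the fibres have cardinality $k$. For a graph $\Gamma$, the relation $u\sim v\iff u^\perp=v^\perp$ (equal neighbourhoods) is an equivalence relation whose classes are cocliques; the reduct $\Gamma/\sim$ has the classes as vertices, with adjacency inherited from representatives. $H_3(\mathbb{F})$: vertices are pairs $(x,X)$ with $x$ a point and $X$ a plane of the projective space $\mathbb{P}(\mathbb{F}^4)$ with $x\not\subset X$; $(x,X)\perp(y,Y)$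 iff $x\subset Y$ and $y\subset X$. Let $V=\mathbb{F}^4$, $V^*$ its dual. $\widetilde H_3(\mathbb{F})$ is the graph whose vertices are the tensors $v\otimes f\in V\otimes V^*$ with $v\in V$, $f\in V^*$, $f(v)\neq0$, with $v\otimes f\perp w\otimes g$ iff $f(w)=g(v)=0$. Let $W=\bigwedge^2V$. Fix an isomorphism $\chi:\bigwedge^4V\to\mathbb{F}$. Identify $\bigwedge^2V^*$ with $(\bigwedge^2V)^*$ via $(f_1\wedge f_2)(v_1\wedge v_2)=f_1(v_1)f_2(v_2)-f_1(v_2)f_2(v_1)$; let $\psi:\bigwedge^2V\to(\bigwedge^2V)^*=\bigwedge^2V^*$ be given by $\psi(\hat w)(\hat v)=\chi(\hat v\wedge\hat w)$, and $\phi=\psi^{-1}:\bigwedge^2V^*\to\bigwedge^2V$. Let $S_2(W)$ be the symmetric square of $W$, with the image of $a\otimes b$ written $ab$. Define $U=(w\wedge x)(y\wedge z)+(w\wedge y)(z\wedge x)+(w\wedge z)(x\wedge y)\in S_2(W)$ for any $w,x,y,z\in V$ with $\chi(w\wedge x\wedge y\wedge z)=1$ (this is independent of the choice). The voltage assignment $\ell:D(\widetilde H_3(\mathbb{F}))\to S_2(W)$ (additive group) assigns to the dart from $v_1\otimes h_1$ to $v_2\otimes h_2$ the element $h_1(v_1)^{-1}h_2(v_2)^{-1}(v_1\wedge v_2)\,\phi(h_1\wedge h_2)$, and $\ell^U$ is the composition of $\ell$ with the projection $S_2(W)\to S_2(W)/\langle U\rangle_{\mathbb{F}_2}$. *)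

(* Defs.v *)
From HB Require Import structures.
From mathcomp Require Import all_boot all_order all_algebra.
From mathcomp Require Import generic_quotient ring_quotient.

Set Implicit Arguments.
Unset Strict Implicit.
Unset Printing Implicit Defensive.

Import Order.TTheory GRing.Theory.
Local Open Scope quotient_scope.
Local Open Scope ring_scope.

Section Graphs.
Variables (T : Type) (adj : T -> T -> Prop).

Definition nbhd_eq (u v : T) : Prop := forall w, adj u w <-> adj v w.

Inductive reach : T -> T -> Prop :=
| reach_refl x : reach x x
| reach_step x y z : adj x y -> reach y z -> reach x z.

Definition connected_graph : Prop := forall x y, reach x y.

Definition reduct_vtx : Type := {C : T -> Prop | exists u, C = nbhd_eq u}.
Definition reduct_adj (C D : reduct_vtx) : Prop :=
  exists u v, sval C u /\ sval D v /\ adj u v.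

Definition comp_vtx (x0 : T) : Type := {y : T | reach x0 y}.
Definition comp_adj (x0 : T) (a b : comp_vtx x0) : Prop := adj (sval a) (sval b).

End Graphs.

Definition local_iso (T T' : Type) (adj : T -> T -> Prop)
  (adj' : T' -> T' -> Prop) (p : T -> T') : Prop :=
  (forall x y, adj x y -> adj' (p x) (p y)) /\
  forall x,
    [/\ (forall y z, adj x y -> adj x z -> p y = p z -> y = z),
        (forall y', adj' (p x) y' -> exists2 y, adj x y & p y = y') &
        (forall y z, adj x y -> adj x z -> (adj y z <-> adj' (p y) (p z)))].

Definition fold_cover (T T' : Type) (adj : T -> T -> Prop)
  (adj' : T' -> T' -> Prop) (K : Type) : Prop :=
  [/\ connected_graph adj, connected_graph adj' &
      exists p : T -> T', local_iso adj adj' p /\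
        forall d : T', exists f : {g : T | p g = d} -> K, bijective f].

(* V = F^4 = 'rV_4 with standard basis e_0..e_3; V^* = 'rV_4 in the    *)
(* dual basis, f(v) = sum_i f_i v_i.                                   *)

Notation I6le := {kl : 'I_6 * 'I_6 | (kl.1 <= kl.2)%N}.
Notation S2 F := {ffun I6le -> F}.

Section Construction.
Variable F : fieldType.

Definition ev (f v : 'rV[F]_4) : F := \sum_(i < 4) f 0 i * v 0 i.

Definition tensor (v f : 'rV[F]_4) : 'M[F]_4 := v^T *m f.

Definition e4 (i : 'I_4) : 'rV[F]_4 := delta_mx 0 i.

(* basis e_i /\ e_j (i<j) of W = /\^2 V, listed in a fixed order *)
Definition o4 (k : nat) : 'I_4 := inord k.
Definition pair_idx : 6.-tuple ('I_4 * 'I_4) :=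
  [tuple (o4 0, o4 1); (o4 0, o4 2); (o4 0, o4 3);
         (o4 1, o4 2); (o4 1, o4 3); (o4 2, o4 3)].
Definition pidx (k : 'I_6) : 'I_4 * 'I_4 := tnth pair_idx k.

(* a /\ b in coordinates w.r.t. the basis e_i /\ e_j (same formula for
   /\^2 V^*, w.r.t. e_i^* /\ e_j^*; with these bases the pairing of
   /\^2 V^* with /\^2 V given in the paper is the dot product) *)
Definition wedge2 (a b : 'rV[F]_4) : 'rV[F]_6 :=
  \row_k (a 0 (pidx k).1 * b 0 (pidx k).2 - a 0 (pidx k).2 * b 0 (pidx k).1).

(* chi : /\^4 V -> F, the isomorphism with chi(e0/\e1/\e2/\e3) = c;
   chi c w x y z = chi(w /\ x /\ y /\ z) *)
Definition chi (c : F) (w x y z : 'rV[F]_4) : F :=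
  c * \det (\matrix_(i < 4, j < 4) (nth 0 [:: w; x; y; z] i) 0 j).

(* matrix of psi : W -> W^*, psi(wh)(vh) = chi(vh /\ wh):
   psi(wh) = wh *m Psi c *)
Definition Psi (c : F) : 'M[F]_6 :=
  \matrix_(q < 6, p < 6)
    chi c (e4 (pidx p).1) (e4 (pidx p).2) (e4 (pidx q).1) (e4 (pidx q).2).

(* phi = psi^-1 : /\^2 V^* -> /\^2 V *)
Definition phi (c : F) (a : 'rV[F]_6) : 'rV[F]_6 := a *m invmx (Psi c).

(* symmetric square S_2(W), in coordinates w.r.t. the basis
   {w_k w_l : k <= l} *)
Local Notation I6le := {kl : 'I_6 * 'I_6 | (kl.1 <= kl.2)%N}.
Local Notation S2 := {ffun I6le -> F}.

Definition sscale (k : F) (s : S2) : S2 := [ffun i => k * s i].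

Definition sym (a b : 'rV[F]_6) : S2 :=
  [ffun kl : I6le => let k := (val kl).1 in let l := (val kl).2 in
     if k == l then a 0 k * b 0 k else a 0 k * b 0 l + a 0 l * b 0 k].

Definition Uelt (w x y z : 'rV[F]_4) : S2 :=
  sym (wedge2 w x) (wedge2 y z) + sym (wedge2 w y) (wedge2 z x)
  + sym (wedge2 w z) (wedge2 x y).

Definition Ht_vtx : Type :=
  {M : 'M[F]_4 | exists p : 'rV[F]_4 * 'rV[F]_4,
                   (M == tensor p.1 p.2) && (ev p.2 p.1 != 0)}.

Definition Ht_adj (a b : Ht_vtx) : Prop :=
  exists v f w g : 'rV[F]_4, [/\ sval a = tensor v f, sval b = tensor w g,
                      ev f w = 0 & ev g v = 0].

Definition rep (a : Ht_vtx) : 'rV[F]_4 * 'rV[F]_4 := xchoose (proj2_sig a).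

Definition voltage (c : F) (a b : Ht_vtx) : S2 :=
  let v1 := (rep a).1 in let h1 := (rep a).2 in
  let v2 := (rep b).1 in let h2 := (rep b).2 in
  sscale ((ev h1 v1)^-1 * (ev h2 v2)^-1) (sym (wedge2 v1 v2) (phi c (wedge2 h1 h2))).

Definition H3_vtx : Type :=
  {p : {vspace 'rV[F]_4} * {vspace 'rV[F]_4} |
     [&& \dim p.1 == 1%N, \dim p.2 == 3%N & ~~ (p.1 <= p.2)%VS]}.

Definition H3_adj (a b : H3_vtx) : Prop :=
  ((val a).1 <= (val b).2)%VS /\ ((val b).1 <= (val a).2)%VS.

End Construction.

Definition spanF2 (F : fieldType) (h : 2%N \in [pchar F]) (U : S2 F)
  : {pred S2 F} := [pred s | (s == 0) || (s == U)].

Lemma spanF2_zmod (F : fieldType) (h : 2%N \in [pchar F]) (U : S2 F) :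
  zmod_closed (spanF2 h U).
Proof.
have UU : U - U = 0 by rewrite subrr.
have UU2 : U + U = 0.
  apply/ffunP => i; rewrite !ffunE -mulr2n -mulr_natr.
  by rewrite (pcharf0 h) mulr0.
have NU : - U = U.
  by apply/esym/eqP; rewrite -addr_eq0 UU2.
split; first by rewrite inE eqxx.
move=> a b; rewrite !inE => /orP[] /eqP -> /orP[] /eqP ->;
  rewrite ?subr0 ?sub0r ?NU ?subrr ?UU2 ?eqxx ?orbT //.
Qed.

HB.instance Definition _ (F : fieldType) (h : 2%N \in [pchar F]) (U : S2 F) :=
  GRing.isZmodClosed.Build (S2 F) (spanF2 h U) (spanF2_zmod h U).

Section Lift.
Variables (F : fieldType) (h : 2%N \in [pchar F]) (c : F) (w x y z : 'rV[F]_4).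

Local Notation SU := (Quotient.quot (spanF2 h (Uelt w x y z))).

Definition Lt_vtx : Type := (Ht_vtx F * SU)%type.
Definition Lt_adj (a b : Lt_vtx) : Prop :=
  Ht_adj a.1 b.1 /\ (\pi_SU (voltage c a.1 b.1) : SU) = a.2 - b.2.

Definition Gam_vtx : Type := reduct_vtx Lt_adj.
Definition Gam_adj : Gam_vtx -> Gam_vtx -> Prop := @reduct_adj _ Lt_adj.

End Lift.

(* Main.v *)
(* The voltage of a dart does not change when the tensors at its ends are
   rescaled, so Gamma is the lift of H_3(F) itself by volt(d, e) =
   (v /\ w) phi(f /\ g), where a vertex of H_3(F) is a pair (v, f) with
   f(v) = 1.  A triangle has voltage U, which makes the projection a local
   isomorphism, so it remains to determine the group of voltages of closed
   walks modulo U; the claim is that it consists of the sums of squares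
   t_0 e_0^2 + ... + t_5 e_5^2 in S_2(W), a copy of F^6.

   Upper bound: S_2(W) modulo squares is the Lie algebra so(W), and in
   characteristic 2 the element c volt(d, e) acts on W as the derivation of the
   matrix P_d + P_e, plus the identity, where P_d = v (x) f is the projector
   attached to d.  Along a closed walk the projectors cancel, and what is left
   is a multiple of the identity counting the darts, that is, a multiple of U
   up to squares.
   Lower bound: a suitable quadrangle has voltage t e_k^2, for any t in F. *)
Require Import Defs.
From HB Require Import structures.
From mathcomp Require Import all_boot all_order all_algebra.
From mathcomp Require Import generic_quotient ring_quotient.
From mathcomp Require Import boolp.
From mathcomp Require Import ring.

Set Implicit Arguments.
Unset Strict Implicit.
Unset Printing Implicit Defensive.

Import Order.TTheory GRing.Theory.
Local Open Scope ring_scope.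

(** * Small determinants by Laplace expansion *)

Lemma det_nat_row (R : comRingType) n (a : nat -> nat -> R) :
  \det (\matrix_(i < n.+1, j < n.+1) a i j) =
  \sum_(j < n.+1) (-1) ^+ j * a 0 j *
     \det (\matrix_(i < n, k < n) a i.+1 (bump j k)).
Proof.
rewrite (expand_det_row _ ord0); apply: eq_bigr => j _.
rewrite mxE /cofactor add0n mulrCA mulrA; congr (_ * \det _).
by apply/matrixP => k l; rewrite !mxE.
Qed.

Lemma det2E (R : comRingType) (a : nat -> nat -> R) :
  \det (\matrix_(i < 2, j < 2) a i j) = a 0 0 * a 1 1 - a 0 1 * a 1 0.
Proof.
rewrite det_nat_row !big_ord_recl big_ord0 !det_mx11 !mxE /= /bump /=.
ring.
Qed.

(** Laplace expansion along the first two rows, into products of complementary 2 x 2 minors, which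
    are coordinates of wedges. Entries indexed by [nat] let the minors compute through [bump]. *)
Lemma det4E (R : comRingType) (a : nat -> nat -> R) :
  \det (\matrix_(i < 4, j < 4) a i j) =
    (a 0 0 * a 1 1 - a 0 1 * a 1 0) * (a 2 2 * a 3 3 - a 2 3 * a 3 2)
  - (a 0 0 * a 1 2 - a 0 2 * a 1 0) * (a 2 1 * a 3 3 - a 2 3 * a 3 1)
  + (a 0 0 * a 1 3 - a 0 3 * a 1 0) * (a 2 1 * a 3 2 - a 2 2 * a 3 1)
  + (a 0 1 * a 1 2 - a 0 2 * a 1 1) * (a 2 0 * a 3 3 - a 2 3 * a 3 0)
  - (a 0 1 * a 1 3 - a 0 3 * a 1 1) * (a 2 0 * a 3 2 - a 2 2 * a 3 0)
  + (a 0 2 * a 1 3 - a 0 3 * a 1 2) * (a 2 0 * a 3 1 - a 2 1 * a 3 0).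
Proof.
rewrite det_nat_row !big_ord_recl big_ord0.
rewrite !(@det_nat_row _ 2 (fun i k => a i.+1 (bump _ k))).
rewrite !big_ord_recl !big_ord0.
rewrite !(det2E (fun i k => a i.+2 (bump _ (bump _ k)))) /= /bump /=.
ring.
Qed.

(** * Exterior and symmetric squares in coordinates *)

Section Coordinates.
Variable F : fieldType.
Implicit Types a b v w x y z f g h : 'rV[F]_4.

Lemma pidxE (k : 'I_6)
  (p := nth (0, 0)%N [:: (0,1); (0,2); (0,3); (1,2); (1,3); (2,3)]%N k) :
  pidx k = (inord p.1, inord p.2).
Proof.
rewrite /p /pidx (tnth_nth (o4 0, o4 0)) /o4.
by case: k {p} => [[|[|[|[|[|[|//]]]]]] ?].
Qed.

Lemma wedge2E a b (k : 'I_6)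
  (p := nth (0, 0)%N [:: (0,1); (0,2); (0,3); (1,2); (1,3); (2,3)]%N k) :
  wedge2 a b 0 k = a 0 (inord p.1) * b 0 (inord p.2)
                 - a 0 (inord p.2) * b 0 (inord p.1).
Proof. by rewrite /wedge2 mxE pidxE. Qed.

Lemma wedge2DC a b : wedge2 b a = - wedge2 a b.
Proof. by apply/rowP => k; rewrite !mxE; ring. Qed.

Lemma wedge2Dl a a' b : wedge2 (a + a') b = wedge2 a b + wedge2 a' b.
Proof. by apply/rowP => k; rewrite !mxE; ring. Qed.

Lemma wedge2Dr a b b' : wedge2 a (b + b') = wedge2 a b + wedge2 a b'.
Proof. by apply/rowP => k; rewrite !mxE; ring. Qed.

Lemma wedge2Zl t a b : wedge2 (t *: a) b = t *: wedge2 a b.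
Proof. by apply/rowP => k; rewrite !mxE; ring. Qed.

Lemma wedge2Zr t a b : wedge2 a (t *: b) = t *: wedge2 a b.
Proof. by apply/rowP => k; rewrite !mxE; ring. Qed.

Lemma chiE c w x y z (p := fun a b k => wedge2 a b 0 (inord k)) :
  chi c w x y z =
  c * (p w x 0%N * p y z 5%N - p w x 1%N * p y z 4%N + p w x 2%N * p y z 3%N
     + p w x 3%N * p y z 2%N - p w x 4%N * p y z 1%N + p w x 5%N * p y z 0%N).
Proof.
have -> : chi c w x y z = c * \det (\matrix_(i < 4, j < 4)
   (fun m n : nat => nth 0 [:: w; x; y; z] m 0 (inord n)) i j).
  congr (_ * \det _); apply/matrixP => i j; rewrite !mxE.
  by rewrite -{1}(inord_val j).
rewrite (det4E (fun m n : nat => nth 0 [:: w; x; y; z] m 0 (inord n))) /=.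
by rewrite /p !wedge2E !inordK.
Qed.

End Coordinates.

Section CharTwo.
Variables (F : fieldType) (h2 : 2%N \in [pchar F]).
Implicit Types (a b v w x y z f g h : 'rV[F]_4) (M : 'M[F]_4).

Lemma two0 : 2 = 0 :> F.
Proof. exact: pcharf0 h2. Qed.
Lemma opp1 : -1 = 1 :> F.
Proof. by have -> : -1 = 1 - 2 :> F by [ring]; rewrite two0 subr0. Qed.

Lemma addrr2 (t : F) : t + t = 0.
Proof. ring: two0. Qed.

Lemma S2_addrr (s : S2 F) : s + s = 0.
Proof. by apply/ffunP => i; rewrite !ffunE addrr2. Qed.

Lemma wedge2_basis (p : 'I_6) :
  wedge2 (e4 F (pidx p).1) (e4 F (pidx p).2) = delta_mx 0 p.
Proof.
apply/rowP => k; rewrite wedge2E pidxE !mxE !eqxx.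
case: p => [[|[|[|[|[|[|//]]]]]] ?]; case: k => [[|[|[|[|[|[|//]]]]]] ?] /=;
rewrite -!val_eqE /= !inordK //=; ring.
Qed.

Lemma chi_scale c w x y z : chi c w x y z = c * chi 1 w x y z.
Proof. by rewrite /chi mul1r. Qed.

(** In the chosen list of pairs, [rev_ord k] is the index of the pair complementary to the one at k;
    the sign of the resulting permutation disappears in characteristic 2. *)
Lemma chi_basis c v w (k : 'I_6) :
  chi c v w (e4 F (pidx k).1) (e4 F (pidx k).2) = c * wedge2 v w 0 (rev_ord k).
Proof.
rewrite chiE /= wedge2_basis !mxE.
have -> : rev_ord k = inord (nth 0 [:: 5; 4; 3; 2; 1; 0] k)%N.
  apply/val_inj; rewrite /= inordK;
  by case: k => [[|[|[|[|[|[|//]]]]]] ?].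
rewrite -!val_eqE; case: k => [[|[|[|[|[|[|//]]]]]] ?] /=;
  rewrite !inordK //=; ring: two0 opp1.
Qed.

(** [Psi c] is c times the permutation matrix of the involution [rev_ord], so its square is the
    scalar c^2. *)
Lemma phiE c (a : 'rV[F]_6) : c != 0 ->
  phi c a = c^-1 *: \row_k a 0 (rev_ord k).
Proof.
move=> c0.
have PsiE q p : Psi c q p = c * (p == rev_ord q)%:R.
  by rewrite mxE chi_basis wedge2_basis !mxE eqxx /= eq_sym.
have PP : Psi c *m Psi c = (c ^+ 2)%:M.
  apply/matrixP => q p; rewrite mxE (bigD1 (rev_ord q)) //= !PsiE big1 => [|j jq].
    rewrite eqxx rev_ordK !mxE eq_sym addr0 mulr1.
    by case: eqP => _; rewrite ?mulr1 ?mulr0 ?mulr1n ?mulr0n.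
  by rewrite !PsiE (negPf jq) mulr0 mul0r.
have /mulmx1_unit[uP _] : Psi c *m (c ^- 2 *: Psi c) = 1%:M.
  by rewrite -scalemxAr PP -scalemx1 scalerA mulVf ?scale1r // expf_neq0.
have bE j : (c^-1 *: \row_k a 0 (rev_ord k)) 0 j = c^-1 * a 0 (rev_ord j).
  by rewrite !mxE.
rewrite /phi; apply: (canLR (mulmxK uP)); apply/rowP => p.
rewrite mxE (bigD1 (rev_ord p)) //= big1 => [|j jp].
  by rewrite bE PsiE rev_ordK eqxx mulr1 mulrC mulrA divff // mul1r addr0.
rewrite PsiE; case: eqP => [E|]; last by rewrite !mulr0.
by rewrite E rev_ordK eqxx in jp.
Qed.

(** U is a multiple of e_01 e_23 + e_02 e_13 + e_03 e_12, the Klein quadratic form. It contains no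
    square, and depends on w, x, y, z only through chi. *)
Lemma UeltE w x y z : Uelt w x y z =
  [ffun i => chi 1 w x y z *+ ((val i).2 == rev_ord (val i).1)].
Proof.
apply/ffunP => -[[k l] /= kl]; rewrite !ffunE /= chiE /= mul1r.
rewrite !wedge2E -!val_eqE /=.
by move: kl; case: k => [[|[|[|[|[|[|//]]]]]] ?];
 case: l => [[|[|[|[|[|[|//]]]]]] ?] //= _; rewrite !inordK //= ?subSS;
 ring: two0 opp1.
Qed.

Lemma ev_e4 i v : ev (e4 F i) v = v 0 i.
Proof.
rewrite /ev (bigD1 i) //= big1 => [|j ji]; rewrite !mxE !eqxx ?mul1r ?addr0 //.
by rewrite (negPf ji) mul0r.
Qed.

(* Complementary minors: compare det M, det N and det (M N), where M has rows
   v1, v2, v3, v4 and N has columns h1, h2 and two coordinate vectors. *)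
Lemma wedge2_dual v1 v2 v3 v4 f1 f2 (k : 'I_6) :
  ev f1 v1 = 1 -> ev f1 v2 = 0 -> ev f1 v3 = 0 -> ev f1 v4 = 0 ->
  ev f2 v1 = 0 -> ev f2 v2 = 1 -> ev f2 v3 = 0 -> ev f2 v4 = 0 ->
  wedge2 v3 v4 0 (rev_ord k) = chi 1 v1 v2 v3 v4 * wedge2 f1 f2 0 k.
Proof.
move=> E11 E12 E13 E14 E21 E22 E23 E24.
pose p := pidx (rev_ord k).
pose vs (i : nat) := nth 0 [:: v1; v2; v3; v4] i.
pose fs (i : nat) := nth 0 [:: f1; f2; e4 F p.1; e4 F p.2] i.
have -> : wedge2 f1 f2 0 k = chi 1 f1 f2 (e4 F p.1) (e4 F p.2).
  by rewrite chi_basis rev_ordK mul1r.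
rewrite /chi !mul1r -[X in _ * X]det_tr -det_mulmx.
have -> : (\matrix_(i < 4, j < 4) nth 0 [:: v1; v2; v3; v4] i 0 j *m
   (\matrix_(i < 4, j < 4) nth 0 [:: f1; f2; e4 F p.1; e4 F p.2] i 0 j)^T)
   = \matrix_(i < 4, j < 4) (fun m n => ev (fs n) (vs m)) i j.
  apply/matrixP => i j; rewrite !mxE; apply: eq_bigr => l _.
  by rewrite !mxE mulrC.
rewrite (det4E (fun m n => ev (fs n) (vs m))) /fs /vs /=.
rewrite E11 E12 E13 E14 E21 E22 E23 E24 !ev_e4 /wedge2 mxE; ring.
Qed.

Lemma symDl (a b a' : 'rV[F]_6) : sym (a + b) a' = sym a a' + sym b a'.
Proof. by apply/ffunP => i; rewrite !ffunE /= !mxE; case: ifP => _; ring. Qed.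

Lemma symZl t (a b : 'rV[F]_6) : sym (t *: a) b = sscale t (sym a b).
Proof. by apply/ffunP => i; rewrite !ffunE /= !mxE; case: ifP => _; ring. Qed.

Lemma symZr t (a b : 'rV[F]_6) : sym a (t *: b) = sscale t (sym a b).
Proof. by apply/ffunP => i; rewrite !ffunE /= !mxE; case: ifP => _; ring. Qed.

Lemma phiZ c t (a : 'rV[F]_6) : phi c (t *: a) = t *: phi c a.
Proof. by rewrite /phi scalemxAl. Qed.

(* The coordinate at e_l of the derivation of /\^2 V induced by M, applied to
   e_p /\ e_q = e_(rev_ord k); M maps e_p to its row p. *)
Definition der M (k l : 'I_6) : F :=
  let p := pidx (rev_ord k) in
  (wedge2 (row p.1 M) (e4 F p.2) + wedge2 (e4 F p.1) (row p.2 M)) 0 l.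

Lemma derD M N k l : der (M + N) k l = der M k l + der N k l.
Proof. rewrite /der !mxE; ring. Qed.

(** Contracting v /\ w with f /\ g recovers the entries of [M] ([ME]), and their full pairing is 1
    ([TE]). With these two relations, every coordinate off the diagonal becomes a polynomial
    identity, checked case by case. *)
Lemma sym_der c v w f g (i : I6le) (k := (val i).1) (l := (val i).2) :
  c != 0 -> k != l ->
  ev f v = 1 -> ev f w = 0 -> ev g v = 0 -> ev g w = 1 ->
  c * sym (wedge2 v w) (phi c (wedge2 f g)) i =
  der (tensor f v + tensor g w) k l + (l == rev_ord k)%:R.
Proof.
move=> c0 kl; rewrite /ev !big_ord_recl !big_ord0.
have -> : ord0 = inord 0 :> 'I_4 by apply/val_inj; rewrite /= inordK.
have -> : lift (inord 0) ord0 = inord 1 :> 'I_4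
  by apply/val_inj; rewrite /= !inordK.
have -> : lift (inord 0) (lift ord0 ord0) = inord 2 :> 'I_4
  by apply/val_inj; rewrite /= !inordK.
have -> : lift (inord 0) (lift ord0 (lift ord0 ord0)) = inord 3 :> 'I_4
  by apply/val_inj; rewrite /= !inordK.
rewrite !addr0 => E11 E12 E21 E22.
set M := tensor f v + tensor g w.
pose A a b (i j : nat) :=
  a 0 (inord i) * b 0 (inord j) - a 0 (inord j) * b 0 (inord i) : F.
have ME (m n : nat) : M (inord m) (inord n) =
   - (A v w n 0%N * A f g 0%N m + A v w n 1%N * A f g 1%N m
    + A v w n 2%N * A f g 2%N m + A v w n 3%N * A f g 3%N m).
  set R := RHS.
  have -> : R = f 0 (inord m) * v 0 (inord n) *
      (g 0 (inord 0) * w 0 (inord 0) + (g 0 (inord 1) * w 0 (inord 1) +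
      (g 0 (inord 2) * w 0 (inord 2) + g 0 (inord 3) * w 0 (inord 3))))
    - g 0 (inord m) * v 0 (inord n) *
      (f 0 (inord 0) * w 0 (inord 0) + (f 0 (inord 1) * w 0 (inord 1) +
      (f 0 (inord 2) * w 0 (inord 2) + f 0 (inord 3) * w 0 (inord 3))))
    - f 0 (inord m) * w 0 (inord n) *
      (g 0 (inord 0) * v 0 (inord 0) + (g 0 (inord 1) * v 0 (inord 1) +
      (g 0 (inord 2) * v 0 (inord 2) + g 0 (inord 3) * v 0 (inord 3))))
    + g 0 (inord m) * w 0 (inord n) *
      (f 0 (inord 0) * v 0 (inord 0) + (f 0 (inord 1) * v 0 (inord 1) +
      (f 0 (inord 2) * v 0 (inord 2) + f 0 (inord 3) * v 0 (inord 3)))).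
    by rewrite /R /A; ring.
  rewrite E11 E12 E21 E22 !mxE !big_ord_recl !big_ord0 !mxE; ring.
have TE : A v w 0%N 1%N * A f g 0%N 1%N + A v w 0%N 2%N * A f g 0%N 2%N
   + A v w 0%N 3%N * A f g 0%N 3%N + A v w 1%N 2%N * A f g 1%N 2%N
   + A v w 1%N 3%N * A f g 1%N 3%N + A v w 2%N 3%N * A f g 2%N 3%N = 1.
  transitivity ((1 : F) * 1 - 0 * 0); last by ring.
  rewrite -{1}E11 -E22 -{1}E12 -E21 /A; ring.
move: M ME TE => M ME TE {E11 E12 E21 E22}.
rewrite phiE // symZr ffunE mulrA divff // mul1r ffunE /= -/k -/l (negPf kl) /der !mxE.
move: TE; set T := (X in X = 1) => TE.
(* As T = 1, the identity term can be multiplied by T; both sides then have degree one in each of v,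
   w, f, g. *)
have -> : (l == rev_ord k)%:R = (l == rev_ord k)%:R * T by rewrite TE mulr1.
(* When l = rev_ord k the two sides, as polynomials over the integers, differ
   by 2 Z. *)
pose Z := (l == rev_ord k)%:R * (T - (v 0 (pidx k).1 * w 0 (pidx k).2 -
  v 0 (pidx k).2 * w 0 (pidx k).1) * (f 0 (pidx k).1 * g 0 (pidx k).2 -
  f 0 (pidx k).2 * g 0 (pidx k).1)).
rewrite -[LHS]addr0 -(mul0r Z) -two0 /Z {Z}.
rewrite !pidxE -!val_eqE; clearbody k l.
move: k l kl => -[[|[|[|[|[|[|//]]]]]] ?] -[[|[|[|[|[|[|//]]]]]] ?] //= _;
  rewrite !inordK //= ?subSS ?subn0 /= !ME /T /A;
  (ring || ring: two0 opp1).
Qed.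

End CharTwo.

(** * Linear functionals, triangles and closed walks *)

Section Duality.
Variable F : fieldType.
Implicit Types (u v w f g h : 'rV[F]_4).

Lemma evE f v : (v *m f^T) 0 0 = ev f v.
Proof. by rewrite mxE; apply: eq_bigr => i _; rewrite mxE mulrC. Qed.

Lemma ev_trE f v : (f *m v^T) 0 0 = ev f v.
Proof. by rewrite mxE; apply: eq_bigr => i _; rewrite mxE. Qed.

Lemma evC f v : ev f v = ev v f.
Proof. by rewrite -ev_trE evE. Qed.

Lemma ev_mx f v : v *m f^T = (ev f v)%:M.
Proof. by rewrite [LHS]mx11_scalar evE. Qed.

Lemma evDr f v w : ev f (v + w) = ev f v + ev f w.
Proof. by rewrite -!evE mulmxDl mxE. Qed.

Lemma evDl f g v : ev (f + g) v = ev f v + ev g v.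
Proof. by rewrite -!evE linearD mulmxDr mxE. Qed.

Lemma evZr f t v : ev f (t *: v) = t * ev f v.
Proof. by rewrite -!evE -scalemxAl mxE. Qed.

Lemma evZl f t v : ev (t *: f) v = t * ev f v.
Proof. by rewrite -!evE linearZ -scalemxAr mxE. Qed.

Lemma evNr f v : ev f (- v) = - ev f v.
Proof. by rewrite -scaleN1r evZr mulN1r. Qed.

Lemma evNl f v : ev (- f) v = - ev f v.
Proof. by rewrite -scaleN1r evZl mulN1r. Qed.

Lemma ev0r f : ev f 0 = 0.
Proof. by rewrite -(scale0r 0) evZr mul0r. Qed.

Lemma ev_e4r f i : ev f (e4 F i) = f 0 i.
Proof.
rewrite /ev (bigD1 i) //= big1 => [|j ji]; rewrite !mxE !eqxx ?mulr1 ?addr0 //.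
by rewrite (negPf ji) mulr0.
Qed.

Lemma ev_extl f g : (forall v, ev f v = ev g v) -> f = g.
Proof. by move=> E; apply/rowP => i; rewrite -!ev_e4r. Qed.

Lemma ev_extr v w : (forall f, ev f v = ev f w) -> v = w.
Proof. by move=> E; apply/rowP => i; rewrite -!ev_e4. Qed.

Lemma ev_neq0r v : v != 0 -> exists f, ev f v = 1.
Proof.
move=> v0; have [i vi|] := pickP (fun i => v 0 i != 0).
  by exists ((v 0 i)^-1 *: e4 F i); rewrite evZl ev_e4 mulVf.
move=> E; case/eqP: v0; apply/rowP => i; rewrite mxE.
by apply/eqP; move/(_ i): E => /negbFE.
Qed.

Lemma ev_neq0l f : f != 0 -> exists v, ev f v = 1.
Proof.
move=> f0; have [i fi|] := pickP (fun i => f 0 i != 0).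
  by exists ((f 0 i)^-1 *: e4 F i); rewrite evZr ev_e4r mulVf.
move=> E; case/eqP: f0; apply/rowP => i; rewrite mxE.
by apply/eqP; move/(_ i): E => /negbFE.
Qed.

Lemma common_zero3 f g h : exists v, [/\ v != 0, ev f v = 0, ev g v = 0 & ev h v = 0].
Proof.
pose H := col_mx f (col_mx g h).
have K0 : kermx H^T != 0.
  rewrite -mxrank_eq0 mxrank_ker mxrank_tr subn_eq0 -ltnNge.
  by apply: leq_ltn_trans (rank_leq_row H) _.
have /rowV0Pn[v] := K0; rewrite sub_kermx => /eqP + v0.
rewrite /H !tr_col_mx !mul_mx_row !ev_mx -[0]row_mx0 => /eq_row_mx[Ef].
rewrite -[0]row_mx0 => /eq_row_mx[Eg Eh]; exists v.
move: Ef Eg Eh => /matrixP/(_ 0 0) + /matrixP/(_ 0 0) + /matrixP/(_ 0 0).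
by rewrite !mxE !mulr1n.
Qed.

(* If every such k(u) vanished then ker f :&: ker g would lie in <v, w>, hence
   be equal to it by dimension, and f v would be 0. *)
Lemma common_nbr v w f g : ev f v != 0 ->
  exists u k, [/\ ev f u = 0, ev g u = 0, ev k v = 0, ev k w = 0 & ev k u = 1].
Proof.
move=> fv.
pose H := col_mx f g; pose A := col_mx v w.
pose K := kermx H^T; pose L := kermx A^T.
have KP i : ev f (row i K) = 0 /\ ev g (row i K) = 0.
  have : row i K *m H^T = 0 by rewrite -row_mul mulmx_ker row0.
  rewrite /H tr_col_mx mul_mx_row !ev_mx -[0]row_mx0.
  move=> /eq_row_mx[/matrixP/(_ 0 0) Ef /matrixP/(_ 0 0) Eg].
  by move: Ef Eg; rewrite !mxE !mulr1n.
have LP i : ev (row i L) v = 0 /\ ev (row i L) w = 0.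
  have : row i L *m A^T = 0 by rewrite -row_mul mulmx_ker row0.
  rewrite /A tr_col_mx mul_mx_row -[0]row_mx0.
  move=> /eq_row_mx[/matrixP/(_ 0 0) Ef /matrixP/(_ 0 0) Eg].
  by move: Ef Eg; rewrite !ev_trE !mxE.
case: (altP (K *m L^T =P 0)) => [KL|/matrix0Pn[i [j ij]]]; last first.
  exists (row i K), ((ev (row j L) (row i K))^-1 *: row j L).
  have [-> ->] := KP i; have [Ev Ew] := LP j.
  rewrite !evZl Ev Ew !mulr0 mulVf //.
  move: ij; rewrite mxE /ev; apply: contraNneq => E; rewrite -[X in _ == X]E.
  by apply/eqP/eq_bigr => l _; rewrite !mxE mulrC.
have KA : (K <= A)%MS.
  (* Double annihilator: [A] lies in the kernel of [L^T] and has the same rank, so the row spaces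
     agree. *)
  have AL : (A <= kermx L^T)%MS.
    by rewrite sub_kermx -trmx_eq0 trmx_mul trmxK mulmx_ker.
  have /eqmxP/eqmx_sym AE : (A == kermx L^T)%MS.
    rewrite -(mxrank_leqif_eq AL).2 mxrank_ker mxrank_tr /L mxrank_ker mxrank_tr.
    by rewrite subKn // rank_leq_col.
  by rewrite -AE sub_kermx KL.
have /eqmxP KE : (K == A)%MS.
  (* [K] has rank at least 4 - 2, and [A] has only two rows. *)
  rewrite -(mxrank_leqif_eq KA).2 eqn_leq (mxrankS KA) /= mxrank_ker mxrank_tr.
  apply: leq_trans (rank_leq_row A) _.
  by rewrite leq_subRL ?(leq_add (rank_leq_row H)) // rank_leq_col.
have : (v <= K)%MS by rewrite KE /A -addsmxE addsmxSl.
rewrite sub_kermx /H tr_col_mx mul_mx_row !ev_mx -[0]row_mx0.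
move=> /eqP/eq_row_mx[/matrixP/(_ 0 0)]; rewrite !mxE mulr1n => E _.
by rewrite E eqxx in fv.
Qed.

End Duality.

Section SymSquare.
Variables (F : fieldType) (h2 : 2%N \in [pchar F]) (c : F) (c0 : c != 0).
Implicit Types (v w f g : 'rV[F]_4).

(** The vanishing minors say v_i w_j = v_j w_i; contracting with f gives f(v) w = f(w) v. *)
Lemma wedge2_eq0 v w f : ev f v = 1 -> ev f w = 0 -> wedge2 v w = 0 -> w = 0.
Proof.
move=> fv fw /rowP vw.
have vwE i j : v 0 i * w 0 j = v 0 j * w 0 i.
  suff H (m n : nat) : (m < n < 4)%N ->
      v 0 (inord m) * w 0 (inord n) = v 0 (inord n) * w 0 (inord m).
    have [|ij|ij] := ltngtP i j.
    - by move=> ij; have := H i j; rewrite !inord_val ij ltn_ord => ->.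
    - by have := H j i; rewrite !inord_val ij ltn_ord => ->.
    - by rewrite (val_inj ij).
  move=> mn; apply/eqP; rewrite -subr_eq0; apply/eqP.
  have E (k : nat) : (k < 6)%N -> wedge2 v w 0 (inord k) = 0.
    by move=> _; rewrite vw mxE.
  case: m n mn => [|[|[|[|m]]]] [|[|[|[|n]]]] //=; rewrite ?andbF // => _;
    [move: (E 0%N isT)|move: (E 1%N isT)|move: (E 2%N isT)
    |move: (E 3%N isT)|move: (E 4%N isT)|move: (E 5%N isT)];
    by rewrite wedge2E inordK.
apply/rowP => j; rewrite mxE -[LHS]mul1r -fv /ev mulr_suml.
transitivity (\sum_(i < 4) v 0 j * (f 0 i * w 0 i)).
  by apply: eq_bigr => i _; rewrite -mulrA vwE mulrCA.
by rewrite -mulr_sumr -/(ev f w) fw mulr0.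
Qed.

Lemma symC (a b : 'rV[F]_6) : sym a b = sym b a.
Proof. by apply/ffunP => i; rewrite !ffunE /=; case: ifP => _; ring. Qed.

Lemma sscaleD k (s t : S2 F) : sscale k (s + t) = sscale k s + sscale k t.
Proof. by apply/ffunP => i; rewrite !ffunE mulrDr. Qed.

(** Let v4 be a nonzero common zero of f1, f2, f3. By [wedge2_dual], each phi(f_i /\ f_j) is (c
    t)^-1 v_k /\ v4 with k the third index, so the sum is a multiple of [Uelt v1 v2 v3 v4], and
    [UeltE] compares the two scalars. *)
Lemma triangle_sum v1 v2 v3 f1 f2 f3 w x y z : chi c w x y z = 1 ->
  ev f1 v1 = 1 -> ev f1 v2 = 0 -> ev f1 v3 = 0 ->
  ev f2 v1 = 0 -> ev f2 v2 = 1 -> ev f2 v3 = 0 ->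
  ev f3 v1 = 0 -> ev f3 v2 = 0 -> ev f3 v3 = 1 ->
  sym (wedge2 v1 v2) (phi c (wedge2 f1 f2))
  + sym (wedge2 v2 v3) (phi c (wedge2 f2 f3))
  + sym (wedge2 v1 v3) (phi c (wedge2 f1 f3)) = Uelt w x y z.
Proof.
move=> hU E11 E12 E13 E21 E22 E23 E31 E32 E33.
have [v4 [v40 E14 E24 E34]] := common_zero3 f1 f2 f3.
set t := chi 1 v1 v2 v3 v4.
have t1 : chi 1 v2 v3 v1 v4 = t.
  by rewrite /t !chiE !wedge2E !inordK //=; ring.
have t2 : chi 1 v1 v3 v2 v4 = t.
  by rewrite /t !chiE !wedge2E !inordK //=; ring: (two0 h2) (opp1 h2).
(* If t were 0, then v3 /\ v4 = 0, and v4 = 0 because f3(v3) = 1 and f3(v4) = 0. *)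
have t0 : t != 0.
  apply: contraNneq v40 => tE; apply/eqP/(@wedge2_eq0 v3 _ f3) => //.
  apply/rowP => k; rewrite -(rev_ordK k) (@wedge2_dual _ h2 v1 v2 v3 v4 f1 f2) //.
  by rewrite -/t tE mul0r mxE.
have phiW (a b : 'rV[F]_6) : (forall k, b 0 (rev_ord k) = t * a 0 k) ->
    phi c a = (c * t)^-1 *: b.
  move=> H; rewrite (phiE h2) //; apply/rowP => k; rewrite !mxE -[in RHS](rev_ordK k) H.
  by rewrite invfM -(mulrA c^-1) mulKf.
rewrite (phiW _ (wedge2 v3 v4)); last by move=> k; apply: wedge2_dual.
rewrite (phiW _ (wedge2 v1 v4)); last by move=> k; rewrite -t1; apply: wedge2_dual.
rewrite (phiW _ (wedge2 v2 v4)); last by move=> k; rewrite -t2; apply: wedge2_dual.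
transitivity (sscale (c * t)^-1 (Uelt v1 v2 v3 v4)).
  rewrite /Uelt (wedge2DC v2 v4) -scaleN1r (opp1 h2) scale1r !sscaleD !symZr.
  by rewrite (symC (wedge2 v2 v3)) addrAC.
rewrite !(UeltE h2) -/t; apply/ffunP => i; rewrite !ffunE.
case: eqP => _; last by rewrite !mulr0n mulr0.
rewrite !mulr1n invfM mulfVK //; apply: (mulfI c0).
by rewrite -chi_scale hU mulfV.
Qed.

(** The coefficients of the e_k^2 are the entries of t themselves, not their squares, so the image
    is the full F-span of the e_k^2. *)
Definition sq (t : 'rV[F]_6) : S2 F :=
  [ffun i => t 0 (val i).1 *+ ((val i).1 == (val i).2)].

Lemma sqD s t : sq (s + t) = sq s + sq t.
Proof. by apply/ffunP => i; rewrite !ffunE mxE mulrnDl. Qed.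

Lemma sq_sum I (r : seq I) (t : I -> 'rV[F]_6) :
  sq (\sum_(i <- r) t i) = \sum_(i <- r) sq (t i).
Proof.
elim/big_rec2: _ => [|i _ s _ <-]; last exact: sqD.
by apply/ffunP => i; rewrite !ffunE mxE mul0rn.
Qed.

(** Off the diagonal, c s is the derivation of M plus n times the identity. Diagonal coordinates,
    the coefficients of squares, are left free. The relation is additive and so can be summed along
    a walk. *)
Definition dart_law (M : 'M[F]_4) n (s : S2 F) := forall i : I6le,
  let k := (val i).1 in let l := (val i).2 in
  k != l -> c * s i = der M k l + (l == rev_ord k)%:R *+ n.

Lemma dart_lawD M N m n s t :
  dart_law M m s -> dart_law N n t -> dart_law (M + N) (m + n) (s + t).
Proof.
move=> Hs Ht i k l kl; rewrite ffunE mulrDr Hs // Ht // derD mulrnDr addrACA.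
by [].
Qed.

Lemma dart_law0 : dart_law 0 0 0.
Proof.
move=> i k l _; rewrite ffunE mulr0 mulr0n addr0 /der !mxE; ring.
Qed.

(** Without a derivation, s and n U agree off the diagonal; as U has no squares, t collects the
    diagonal of s. *)
Lemma dart_law_closed n s w x y z : chi c w x y z = 1 ->
  dart_law 0 n s -> exists t, s = sq t + Uelt w x y z *+ n.
Proof.
move=> hU Hs.
pose d (k : 'I_6) : I6le := exist _ (k, k) (leqnn k).
exists (\row_k s (d k)); apply/ffunP => i; rewrite (UeltE h2) !ffunE mxE.
have -> : ([ffun i : I6le => chi 1 w x y z *+ ((val i).2 == rev_ord (val i).1)]
  *+ n) i = chi 1 w x y z *+ ((val i).2 == rev_ord (val i).1) *+ n.
  by elim: n {Hs} => [|n IH]; rewrite ?mulr0n ?mulrS !ffunE ?IH.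
case: i => -[k l] kl /=; have [E|nkl] := eqVneq k l.
  have -> : (l == rev_ord k) = false.
    rewrite -E -val_eqE /=.
    by case: k {kl E} => [[|[|[|[|[|[|//]]]]]] ?]; rewrite ?subSS.
  rewrite mulr0n mul0rn addr0 mulr1n; congr (s _); apply: val_inj => /=.
  by rewrite E.
rewrite mulr0n add0r; apply: (mulfI c0).
rewrite (Hs (exist _ (k, l) kl)) //=.
have -> : der 0 k l = 0 :> F by rewrite /der !mxE; ring.
by rewrite add0r [RHS]mulrnAr [c * _]mulrnAr -chi_scale hU.
Qed.

(** The diagonal of U vanishes because k is never [rev_ord k]. This makes the squares embed in the
    quotient by U. *)
Lemma sq_Uelt t w x y z : chi c w x y z = 1 ->
  sq t = 0 \/ sq t = Uelt w x y z -> t = 0.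
Proof.
move=> hU H; apply/rowP => k; rewrite mxE.
have := erefl (sq t (exist _ (k, k) (leqnn k))).
rewrite {1}ffunE /= eqxx mulr1n => ->; case: H => ->; first by rewrite ffunE.
rewrite (UeltE h2) ffunE /= -val_eqE /=.
by case: k => [[|[|[|[|[|[|//]]]]]] ?]; rewrite ?subSS.
Qed.

End SymSquare.

(** * Point-plane pairs and the graph H_3 *)

Section Antiflags.
Variable F : fieldType.
Implicit Types (u v w f g h : 'rV[F]_4) (d e : H3_vtx F).

Definition hker f : {vspace 'rV[F]_4} := lker (linfun (mulmxr f^T)).

Lemma mem_hker u f : (u \in hker f) = (ev f u == 0).
Proof.
rewrite memv_ker lfunE /= ev_mx; apply/eqP/eqP => [/matrixP/(_ 0 0)|->].
  by rewrite !mxE mulr1n.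
by apply/matrixP => i j; rewrite !mxE mul0rn.
Qed.

Lemma dim_hker f : f != 0 -> \dim (hker f) = 3.
Proof.
move=> /ev_neq0l[v fv].
have := limg_ker_dim (linfun (mulmxr f^T : 'rV_4 -> 'rV_1)) fullv.
rewrite capfv -/(hker f) dimvf /dim /= mul1n.
suff -> : \dim (limg (linfun (mulmxr f^T : 'rV_4 -> 'rV_1))) = 1%N.
  by rewrite addn1 => -[].
apply/eqP; rewrite eqn_leq; apply/andP; split.
  by apply: leq_trans (dimvS (subvf _)) _; rewrite dimvf.
rewrite lt0n dimv_eq0; apply/negP => /eqP E.
have : linfun (mulmxr f^T) v \in limg (linfun (mulmxr f^T : 'rV_4 -> 'rV_1)).
  by apply: memv_img; rewrite memvf.
rewrite E memv0 lfunE /= ev_mx fv => /eqP/matrixP/(_ 0 0)/eqP.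
by rewrite !mxE oner_eq0.
Qed.

Lemma dim3_hker (X : {vspace 'rV[F]_4}) : \dim X = 3 ->
  exists2 f, f != 0 & X = hker f.
Proof.
move=> X3; pose B := \matrix_(i < \dim X) (vbasis X)`_i.
have : kermx B^T != 0.
  rewrite -mxrank_eq0 mxrank_ker mxrank_tr subn_eq0 -ltnNge.
  by apply: leq_ltn_trans (rank_leq_row B) _; rewrite X3.
move=> /rowV0Pn[f]; rewrite sub_kermx => /eqP fB f0.
exists f => //; apply/eqP; rewrite eqEdim dim_hker // X3 leqnn andbT.
apply/subvP => u /coord_vbasis ->; rewrite memv_suml // => i _.
apply: memvZ; rewrite mem_hker -ev_trE.
move: fB => /matrixP/(_ 0 i); rewrite mxE [RHS]mxE => fB.
by apply/eqP; rewrite -[RHS]fB mxE; apply: eq_bigr => j _; rewrite !mxE.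
Qed.

Lemma antiflag_subproof v f : ev f v = 1 ->
  [&& \dim <[v]> == 1, \dim (hker f) == 3 & ~~ (<[v]> <= hker f)%VS].
Proof.
move=> fv; rewrite -memvE mem_hker fv oner_eq0 dim_vline dim_hker; last first.
  by apply: contra_eq_neq fv => ->; rewrite -evE trmx0 mulmx0 mxE eq_sym oner_eq0.
by have [v0|//] := eqVneq v 0; move/eqP: fv; rewrite v0 ev0r eq_sym oner_eq0.
Qed.

Definition antiflag v f (fv : ev f v = 1) : H3_vtx F :=
  exist _ (<[v]>%VS, hker f) (antiflag_subproof fv).

Lemma antiflag_rep d : exists p : 'rV[F]_4 * 'rV[F]_4,
  [&& (val d).1 == <[p.1]>%VS, (val d).2 == hker p.2 & ev p.2 p.1 == 1].
Proof.
case: d => -[x X] /= /and3P[/eqP x1 /eqP X3 xX].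
have [f f0 XE] := dim3_hker X3.
have [v xE] : exists v, x = <[v]>%VS.
  exists (vpick x); apply/eqP; rewrite eq_sym eqEdim -memvE memv_pick x1.
  by rewrite dim_vline vpick0 -dimv_eq0 x1.
have fv : ev f v != 0 by rewrite -mem_hker -XE memvE -xE.
exists ((ev f v)^-1 *: v, f); rewrite /= evZr mulVf // XE xE !eqxx /= !andbT.
rewrite eqEdim -!memvE !dim_vline scaler_eq0 invr_eq0 (negPf fv) /= leqnn andbT.
by apply/vlineP; exists (ev f v); rewrite scalerA divff // scale1r.
Qed.

Definition pt d := (xchoose (antiflag_rep d)).1.
Definition fn d := (xchoose (antiflag_rep d)).2.

Lemma ev_fn_pt d : ev (fn d) (pt d) = 1.
Proof. by have /and3P[_ _ /eqP] := xchooseP (antiflag_rep d). Qed.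

Lemma antiflagK d : antiflag (ev_fn_pt d) = d.
Proof.
apply: val_inj => /=; have /and3P[/eqP E1 /eqP E2 _] := xchooseP (antiflag_rep d).
by rewrite [RHS]surjective_pairing; congr (_, _).
Qed.

Lemma eq_antiflag v f w g (fv : ev f v = 1) (gw : ev g w = 1) t : t != 0 ->
  w = t *: v -> g = t^-1 *: f -> antiflag fv = antiflag gw.
Proof.
move=> t0 E1 E2; apply: val_inj => /=; congr (_, _).
  apply/eqP; rewrite eqEdim -memvE !dim_vline E1 scaler_eq0 (negPf t0) leqnn andbT.
  by apply/vlineP; exists t^-1; rewrite scalerA mulVf // scale1r.
by apply/vspaceP => u; rewrite !mem_hker E2 evZl mulf_eq0 invr_eq0 (negPf t0).
Qed.

(** Equality of lines gives w = t v. For g, evaluate on u - f(u) v, which lies in the common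
    kernel. *)
Lemma antiflag_inj v f w g (fv : ev f v = 1) (gw : ev g w = 1) :
  antiflag fv = antiflag gw ->
  exists t, [/\ t != 0, w = t *: v & g = t^-1 *: f].
Proof.
move=> /(congr1 val)/= E; have /= E1 := congr1 fst E; have /= E2 := congr1 snd E.
have /vlineP[t wE] : w \in <[v]>%VS by rewrite E1 memv_line.
have t0 : t != 0.
  by apply: contra_eq_neq gw => t0; rewrite wE t0 scale0r ev0r eq_sym oner_eq0.
exists t; split=> //; apply: ev_extl => u.
have : u - ev f u *: v \in hker f by rewrite mem_hker evDr evNr evZr fv mulr1 subrr.
rewrite E2 mem_hker evDr evNr evZr subr_eq0 => /eqP ->.
have -> : v = t^-1 *: w by rewrite wE scalerA mulVf // scale1r.
by rewrite evZr gw mulr1 evZl mulrC.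
Qed.

Lemma adj_antiflag v f w g (fv : ev f v = 1) (gw : ev g w = 1) :
  H3_adj (antiflag fv) (antiflag gw) <-> ev f w = 0 /\ ev g v = 0.
Proof.
rewrite /H3_adj /= -!memvE !mem_hker.
by split=> [[/eqP ? /eqP ?]|[-> ->]].
Qed.

Lemma H3_adjE d e : H3_adj d e <-> ev (fn d) (pt e) = 0 /\ ev (fn e) (pt d) = 0.
Proof. by rewrite -{1}(antiflagK d) -{1}(antiflagK e) adj_antiflag. Qed.

Lemma H3_adj_sym d e : H3_adj d e -> H3_adj e d.
Proof. by case. Qed.

(** The case d = e is included: it supplies a neighbour of any vertex. *)
Lemma H3_common_nbr d e : exists a, H3_adj d a /\ H3_adj a e.
Proof.
have fv : ev (fn d) (pt d) != 0 by rewrite ev_fn_pt oner_eq0.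
have [u [k [fu gu kv kw ku]]] := common_nbr (pt e) (fn e) fv.
exists (antiflag ku); rewrite -{1}(antiflagK d) -{1}(antiflagK e) !adj_antiflag.
by [].
Qed.

Lemma H3_connected : connected_graph (@H3_adj F).
Proof.
move=> d e; have [a [da ae]] := H3_common_nbr d e.
by apply: reach_step da _; apply: reach_step ae _; apply: reach_refl.
Qed.

(** Every nonzero u in ker f is the point of some neighbour, so ker f lies in ker g; dually for
    planes through v. Hence g and w are multiples of f and v. *)
Lemma H3_nbhd_inj d e : nbhd_eq (@H3_adj F) d e -> d = e.
Proof.
rewrite -(antiflagK d) -(antiflagK e); move: (ev_fn_pt d) (ev_fn_pt e).
move: (pt d) (fn d) (pt e) (fn e) => v f w g fv gw N.
have Nuk u k (ku : ev k u = 1) : ev f u = 0 -> ev k v = 0 ->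
    ev g u = 0 /\ ev k w = 0.
  move=> fu kv; apply/(adj_antiflag gw ku)/N/adj_antiflag.
  by [].
have fg u : ev f u = 0 -> ev g u = 0.
  have [->|u0 fu] := eqVneq u 0; first by rewrite !ev0r.
  have [k ku] := ev_neq0r u0.
  (* The correction makes the functional vanish at v and keeps its value 1 at u, since f(u) = 0. *)
  have := Nuk u (k - ev k v *: f); rewrite !evDl !evNl !evZl fu ku mulr0 subr0.
  by rewrite fv mulr1 subrr => /(_ erefl erefl erefl)[].
have vw k : ev k v = 0 -> ev k w = 0.
  have [->|k0 kv] := eqVneq k 0; first by rewrite -!evE trmx0 !mulmx0 mxE.
  have [u ku] := ev_neq0l k0.
  have := Nuk (u - ev f u *: v) k; rewrite !evDr !evNr !evZr kv ku mulr0 subr0.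
  by rewrite fv mulr1 subrr => /(_ erefl erefl erefl)[].
have wE : w = ev f w *: v.
  apply: ev_extr => k; apply/eqP; rewrite -subr_eq0 evZr.
  have := vw (k - ev k v *: f); rewrite !evDl !evNl !evZl fv mulr1 subrr.
  by move=> /(_ erefl) <-; rewrite mulrC.
have gE : g = ev g v *: f.
  apply: ev_extl => u; apply/eqP; rewrite -subr_eq0 evZl.
  have := fg (u - ev f u *: v); rewrite !evDr !evNr !evZr fv mulr1 subrr.
  by move=> /(_ erefl) <-; rewrite mulrC.
have E : ev g v * ev f w = 1 by rewrite -[RHS]gw [in RHS]wE evZr mulrC.
have t0 : ev f w != 0.
  by apply: contra_eq_neq E => ->; rewrite mulr0 eq_sym oner_eq0.
apply: (eq_antiflag _ _ t0 wE); rewrite {1}gE; congr (_ *: _).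
by apply: (mulIf t0); rewrite E mulVf.
Qed.

Variables (c : F).

Definition volt d e := sym (wedge2 (pt d) (pt e)) (phi c (wedge2 (fn d) (fn e))).

(** Normalised representatives are unique up to (t v, t^-1 f), and these scalars cancel in the
    product. *)
Lemma volt_antiflag v f w g (fv : ev f v = 1) (gw : ev g w = 1) :
  volt (antiflag fv) (antiflag gw) = sym (wedge2 v w) (phi c (wedge2 f g)).
Proof.
rewrite /volt.
have [s [s0 -> ->]] := antiflag_inj (esym (antiflagK (antiflag fv))).
have [t [t0 -> ->]] := antiflag_inj (esym (antiflagK (antiflag gw))).
rewrite !wedge2Zl !wedge2Zr !phiZ !symZl !symZr.
move: (sym _ _) => S; apply/ffunP => i; rewrite !ffunE.
by field; rewrite s0 t0.
Qed.

End Antiflags.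

(** * Lifts and reducts of graphs *)

Section Reach.
Variables (T : Type) (adj : T -> T -> Prop).

Lemma reach_trans x y z : reach adj x y -> reach adj y z -> reach adj x z.
Proof.
by elim=> [//|a b d ab _ IH] /IH; apply: reach_step.
Qed.

Lemma reach_edge x y : adj x y -> reach adj x y.
Proof. by move=> xy; apply: reach_step xy (reach_refl _ _). Qed.

Lemma reach_sym : (forall x y, adj x y -> adj y x) ->
  forall x y, reach adj x y -> reach adj y x.
Proof.
move=> adjC x y; elim=> [a|a b d ab _ IH]; first exact: reach_refl.
by apply: reach_trans IH (reach_edge _); apply: adjC.
Qed.

Lemma reach_map (T' : Type) (adj' : T' -> T' -> Prop) (p : T -> T') :
  (forall x y, adj x y -> adj' (p x) (p y)) ->
  forall x y, reach adj x y -> reach adj' (p x) (p y).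
Proof.
move=> padj x y; elim=> [a|a b d ab _ IH]; first exact: reach_refl.
by apply: reach_step IH; apply: padj.
Qed.

Lemma comp_vtx_inj x0 (a b : comp_vtx adj x0) : sval a = sval b -> a = b.
Proof. by case: a b => a pa [b pb] /= E; apply: eq_exist. Qed.

Lemma comp_connected x0 : (forall x y, adj x y -> adj y x) ->
  connected_graph (@comp_adj _ adj x0).
Proof.
(* Stated for arbitrary [a], [b] over the ends, so that the induction runs on a walk in the whole
   graph. *)
move=> adjC; have H y z (yz : reach adj y z) : forall a b : comp_vtx adj x0,
    sval a = y -> sval b = z -> reach (@comp_adj _ adj x0) a b.
  elim: yz => [u a b au bu|u v w uv _ IH a b au bw].
    by rewrite (comp_vtx_inj (etrans au (esym bu))); apply: reach_refl.
  have x0v : reach adj x0 v.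
    by apply: reach_trans (svalP a) (reach_edge _); rewrite au.
  apply: reach_step (IH (exist _ v x0v) b erefl bw).
  by rewrite /comp_adj au.
move=> a b; apply: (H _ _ _ a b) => //.
by apply: reach_trans (svalP b); apply: reach_sym (svalP a).
Qed.

End Reach.

Lemma inj_surj_bij (A B : Type) (f : A -> B) :
  injective f -> (forall y, exists x, f x = y) -> bijective f.
Proof.
move=> f_inj /choice[g fg]; exists g => // x; exact: f_inj.
Qed.

Section LiftCover.
Variables (D : Type) (adjD : D -> D -> Prop) (N : zmodType) (l : D -> D -> N).
Hypothesis adjD_sym : forall d e, adjD d e -> adjD e d.
Hypothesis l_sym : forall d e, adjD d e -> l e d = - l d e.

Definition lift_adj (p q : D * N) := adjD p.1 q.1 /\ l p.1 q.1 = p.2 - q.2.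

Lemma lift_adj_sym p q : lift_adj p q -> lift_adj q p.
Proof.
by case=> pq E; split; [exact: adjD_sym|rewrite l_sym // E opprB].
Qed.

Lemma lift_adj_out d m e : adjD d e -> lift_adj (d, m) (e, m - l d e).
Proof. by move=> de; split; rewrite //= opprB addrCA subrr addr0. Qed.

Lemma lift_reach d e m : reach adjD d e -> exists n, reach lift_adj (d, m) (e, n).
Proof.
move=> de; elim: de m => [a m|a b f ab _ IH m]; first by exists m; apply: reach_refl.
have [n H] := IH (m - l a b); exists n.
by apply: reach_step H; apply: lift_adj_out.
Qed.

Lemma reach_translate t p q : reach lift_adj p q ->
  reach lift_adj (p.1, p.2 + t) (q.1, q.2 + t).
Proof.
move=> pq; refine (reach_map (p := fun p => (p.1, p.2 + t)) _ pq) => u v [uv E].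
by split; rewrite //= E opprD addrACA subrr addr0.
Qed.

Hypothesis adjD_connected : connected_graph adjD.

(** The net voltages of closed walks, up to sign; [loopI] shows that one base point suffices. *)
Definition loop t := forall d m, reach lift_adj (d, m) (d, m + t).

(** Walk from e to d, follow a translate of the given walk, and return along a translate of the
    first walk; translations are automorphisms of the lift. *)
Lemma loopI t d m : reach lift_adj (d, m) (d, m + t) -> loop t.
Proof.
move=> dt e n; have [k nk] := lift_reach n (adjD_connected e d).
apply: (reach_trans nk); have := reach_translate (k - m) dt.
have E : m + (k - m) = k by rewrite addrC subrK.
rewrite /= [m + t]addrC -[t + m + _]addrA E [t + k]addrC => H; apply: (reach_trans H).
apply: reach_sym lift_adj_sym _ _ _; exact: (reach_translate t nk).
Qed.

Lemma loop0 : loop 0.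
Proof. by move=> d m; rewrite addr0; apply: reach_refl. Qed.

Lemma loopD s t : loop s -> loop t -> loop (s + t).
Proof. by move=> Hs Ht d m; apply: reach_trans (Hs d m) _; rewrite addrA. Qed.

(** The sign arises because a step along a dart subtracts its voltage. *)
Lemma loop_quadrangle a b d e :
  adjD a b -> adjD b d -> adjD d e -> adjD e a ->
  loop (- (l a b + l b d + l d e + l e a)).
Proof.
move=> ab bd de ea; apply: (@loopI _ a 0).
have s1 := lift_adj_out 0 ab; have s2 := lift_adj_out (0 - l a b) bd.
have s3 := lift_adj_out (0 - l a b - l b d) de.
have s4 := lift_adj_out (0 - l a b - l b d - l d e) ea.
apply: reach_step s1 (reach_step s2 (reach_step s3 _)).
by rewrite !opprD !addrA in s4 *; apply: reach_edge.
Qed.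

Hypothesis l_triangle : forall d e f,
  adjD d e -> adjD e f -> adjD d f -> l d e + l e f = l d f.

Variables (G : Type) (adjG : G -> G -> Prop) (r : G -> D * N).
Hypothesis r_inj : injective r.
Hypothesis r_surj : forall p, exists a, r a = p.
Hypothesis adjGE : forall a b, adjG a b <-> lift_adj (r a) (r b).

(** [k] parametrises the voltages of closed walks without repetition. *)
Variables (K : Type) (k : K -> N).
Hypothesis k_inj : injective k.
Hypothesis loop_k : forall t, loop (k t).
Hypothesis k_loop : forall d m n, reach lift_adj (d, m) (d, n) ->
  exists t, n = m + k t.

Lemma reach_rI p q : reach lift_adj p q ->
  forall a b, r a = p -> r b = q -> reach adjG a b.
Proof.
elim=> [u a b au bu|u v w uv _ IH a b au bw].
  by rewrite (r_inj (etrans au (esym bu))); apply: reach_refl.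
have [e ev] := r_surj v; apply: reach_step (IH e b ev bw).
by apply/adjGE; rewrite au ev.
Qed.

(** Neighbours of (d, m) correspond to neighbours of d, and [l_triangle] makes two of them adjacent
    once their projections are. The part of the component over d is a coset n + k(K). *)
Lemma lift_fold_cover x0 : fold_cover (@comp_adj _ adjG x0) adjD K.
Proof.
have adjG_sym a b : adjG a b -> adjG b a.
  by move=> /adjGE ab; apply/adjGE/lift_adj_sym.
split=> //; first exact: comp_connected.
exists (fun a => (r (sval a)).1); split.
  split=> [a b /adjGE[]//|a]; split.
  - move=> y z /adjGE[_ Ey] /adjGE[_ Ez] E; apply/comp_vtx_inj/r_inj.
    rewrite [LHS]surjective_pairing [RHS]surjective_pairing E; congr (_, _).
    by apply: oppr_inj; apply: (addrI (r (sval a)).2); rewrite -Ey -Ez E.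
  - move=> d ad; have [y yE] := r_surj (d, (r (sval a)).2 - l (r (sval a)).1 d).
    have ay : adjG (sval a) y.
      by apply/adjGE; rewrite yE [r _]surjective_pairing; apply: lift_adj_out.
    have x0y := reach_trans (svalP a) (reach_edge ay).
    by exists (exist _ y x0y); rewrite //= yE.
  - move=> y z /adjGE[ay Ey] /adjGE[az Ez]; split=> [/adjGE[]//|yz].
    apply/adjGE; split=> //; apply: (addrI (l (r (sval a)).1 (r (sval y)).1)).
    by rewrite l_triangle // Ey Ez addrA subrK.
move=> d; have [n x0n] := lift_reach (r x0).2 (adjD_connected (r x0).1 d).
have [z zE] := r_surj (d, n).
have x0z : reach adjG x0 z.
  by apply: reach_rI x0n _ _ _ zE; rewrite -surjective_pairing.
have fib (g : {g : comp_vtx adjG x0 | (r (sval g)).1 = d}) :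
    exists t, (r (sval (sval g))).2 = n + k t.
  case: g => -[y x0y] /= yd; apply: (k_loop (d := d)).
  rewrite -zE -yd -surjective_pairing.
  apply: (reach_map (adj := adjG)) => [u v /adjGE//|].
  by apply: reach_trans x0y; apply: reach_sym.
have [f fE] := choice fib; exists f; apply: inj_surj_bij.
  move=> g h E; have := fE g; rewrite E -fE => E2.
  case: g h E E2 => g gd [h hd] /= _ E2; apply: eq_exist; apply/comp_vtx_inj/r_inj.
  by rewrite [LHS]surjective_pairing [RHS]surjective_pairing E2 gd hd.
move=> t; have [y yE] := r_surj (d, n + k t).
have x0y : reach adjG x0 y.
  by apply: reach_trans x0z (reach_rI _ zE yE); apply: loop_k.
have yd : (r (sval (exist (reach adjG x0) y x0y))).1 = d by rewrite /= yE.
exists (exist _ (exist _ y x0y) yd); apply: k_inj; apply: (addrI n).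
by rewrite -fE /= yE.
Qed.

End LiftCover.

Section Reduct.
Variables (T L : Type) (adj : T -> T -> Prop) (adjL : L -> L -> Prop) (q : T -> L).
Hypothesis q_surj : forall p, exists u, q u = p.
Hypothesis adjE : forall u v, adj u v <-> adjL (q u) (q v).
Hypothesis L_reduced : forall a b, nbhd_eq adjL a b -> a = b.

Lemma nbhd_eqE u v : nbhd_eq adj u v <-> q u = q v.
Proof.
split=> [uv|uv w]; last by rewrite !adjE uv.
by apply: L_reduced => p; have [w <-] := q_surj p; rewrite -!adjE.
Qed.

(** By [nbhd_eqE] the classes are the fibres of [q], so the reduct is a copy of the target graph. *)
Lemma reduct_iso : exists r : reduct_vtx adj -> L,
  [/\ injective r, forall p, exists C, r C = p &
      forall C E, reduct_adj C E <-> adjL (r C) (r E)].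
Proof.
have /choice[s sP] : forall C : reduct_vtx adj, exists u, sval C = nbhd_eq adj u.
  by move=> C; exact: svalP C.
have sE C u : sval C u <-> q (s C) = q u by rewrite sP nbhd_eqE.
exists (q \o s); split=> [C E CE|p|C E] /=.
- case: C E CE (sP C) (sP E) => C pC [E pE] /= CE C1 E1; apply: eq_exist.
  rewrite C1 E1; apply: funext => u; apply: propext.
  by rewrite !nbhd_eqE CE.
- have [u <-] := q_surj p.
  exists (exist _ (nbhd_eq adj u) (ex_intro _ u erefl)).
  by apply/sE => w; split.
- split=> [[u [v [/sE -> [/sE -> /adjE]]]]//|CE].
  exists (s C), (s E); rewrite !sE; split=> //; split=> //.
  exact/adjE.
Qed.

End Reduct.

(** * The voltage group of H_3 *)

Section Tensors.
Variable F : fieldType.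
Implicit Types (v w f g : 'rV[F]_4) (a b : Ht_vtx F).

(** Contracting the equality with v and then with f gives t = f(v) / g(v). *)
Lemma tensor_eq v f w g : tensor v f = tensor w g -> ev f v != 0 ->
  exists t, [/\ t != 0, w = t *: v & g = t^-1 *: f].
Proof.
rewrite /tensor => E fv.
have Ev : ev f v *: v = ev g v *: w.
  have := congr1 (fun M => (M *m v^T)^T) E.
  by rewrite /= -!mulmxA !ev_mx !mul_mx_scalar !linearZ /= !trmxK !(evC v).
have gv : ev g v != 0.
  apply: contra_neq fv => gv; have := congr1 (ev f) Ev.
  by rewrite gv scale0r ev0r evZr => /eqP; rewrite mulf_eq0 orbb => /eqP.
have wE : w = (ev f v / ev g v) *: v.
  by rewrite mulrC -scalerA Ev scalerA mulVf // scale1r.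
have : ev f v / ev g v != 0 by rewrite mulf_neq0 ?invr_eq0.
move: (ev f v / ev g v) wE => t wE t0; exists t; split=> //.
suff -> : f = t *: g by rewrite scalerA mulVf // scale1r.
apply: (scalerI fv); have := congr1 (fun M => f *m M) E.
rewrite /= wE linearZ /= -scalemxAl -scalemxAr !mulmxA ev_mx !mul_scalar_mx.
by rewrite (evC v) => ->; rewrite !scalerA mulrC.
Qed.

Lemma rep_tensor a : sval a = tensor (rep a).1 (rep a).2.
Proof. by have /andP[/eqP] := xchooseP (proj2_sig a). Qed.

Lemma rep_ev a : ev (rep a).2 (rep a).1 != 0.
Proof. by have /andP[] := xchooseP (proj2_sig a). Qed.

Lemma Ht_proj_subproof a : ev ((ev (rep a).2 (rep a).1)^-1 *: (rep a).2) (rep a).1 = 1.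
Proof. by rewrite evZl mulVf ?rep_ev. Qed.

Definition Ht_proj a : H3_vtx F := antiflag (Ht_proj_subproof a).

Lemma Ht_proj_surj d : exists a, Ht_proj a = d.
Proof.
have H : exists p : 'rV[F]_4 * 'rV[F]_4,
    (tensor (pt d) (fn d) == tensor p.1 p.2) && (ev p.2 p.1 != 0).
  by exists (pt d, fn d); rewrite eqxx ev_fn_pt oner_eq0.
pose a : Ht_vtx F := exist _ _ H; exists a.
have [t [t0 E1 E2]] := tensor_eq (esym (rep_tensor a)) (rep_ev a).
rewrite -[RHS]antiflagK; apply: (eq_antiflag _ _ t0 E1).
have := ev_fn_pt d; rewrite E1 E2 evZl evZr mulrA mulVf // mul1r => ->.
by rewrite invr1 scale1r.
Qed.

Lemma Ht_adjE a b : Ht_adj a b <-> H3_adj (Ht_proj a) (Ht_proj b).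
Proof.
rewrite adj_antiflag !evZl; have fa := rep_ev a; have fb := rep_ev b.
split=> [[v [f [w [g [aE bE fw gv]]]]]|[]].
  have [s [s0 vE fE]] := tensor_eq (etrans (esym (rep_tensor a)) aE) fa.
  have [t [t0 wE gE]] := tensor_eq (etrans (esym (rep_tensor b)) bE) fb.
  move: fw gv; rewrite vE fE wE gE !evZl !evZr.
  move=> /eqP; rewrite !mulf_eq0 !invr_eq0 (negPf s0) (negPf t0) /= => /eqP ->.
  move=> /eqP; rewrite !mulf_eq0 !invr_eq0 (negPf s0) (negPf t0) /= => /eqP ->.
  by rewrite !mulr0.
move=> /eqP; rewrite mulf_eq0 invr_eq0 (negPf fa) => /eqP fw.
move=> /eqP; rewrite mulf_eq0 invr_eq0 (negPf fb) => /eqP gv.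
exists (rep a).1, (rep a).2, (rep b).1, (rep b).2.
by rewrite -!rep_tensor.
Qed.

(** The inverse factors in [voltage] are exactly those that normalise the two functionals. *)
Lemma voltageE c a b : voltage c a b = volt c (Ht_proj a) (Ht_proj b).
Proof.
rewrite volt_antiflag wedge2Zl wedge2Zr !phiZ !symZr /voltage /=.
by move: (sym _ _) => S; apply/ffunP => i; rewrite !ffunE mulrA.
Qed.

End Tensors.

Section Assembly.
Variables (F : fieldType) (h2 : 2%N \in [pchar F]) (c : F) (c0 : c != 0).
Variables (w x y z : 'rV[F]_4) (hU : chi c w x y z = 1).
Local Notation SU := (Quotient.quot (spanF2 h2 (Uelt w x y z))).
Local Notation H3 := (H3_vtx F).
Implicit Types (d e : H3) (s : S2 F).

Definition proj (s : S2 F) : SU := \pi_SU%qT s.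

Lemma projD s (t : S2 F) : proj (s + t) = proj s + proj t.
Proof. exact: Quotient.pi_add. Qed.

Lemma proj0 : proj 0 = 0.
Proof. by apply: (addrI (proj 0)); rewrite -projD !addr0. Qed.

Lemma proj_surj (m : SU) : exists s, proj s = m.
Proof. by exists (repr m); rewrite /proj reprK. Qed.

Lemma SU_addrr (m : SU) : m + m = 0.
Proof. by have [s <-] := proj_surj m; rewrite -projD S2_addrr // proj0. Qed.

Lemma SU_opp (m : SU) : - m = m.
Proof. by apply/esym/eqP; rewrite -addr_eq0 SU_addrr. Qed.

Lemma proj_eq0 s : proj s = 0 <-> s = 0 \/ s = Uelt w x y z.
Proof.
rewrite -proj0 /proj; split=> [/eqP|].
  by rewrite -Quotient.idealrBE subr0 => /orP[/eqP|/eqP]; [left|right].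
by move=> E; apply/eqP; rewrite -Quotient.idealrBE subr0; apply/orP;
  case: E => ->; rewrite eqxx; [left|right].
Qed.

Definition volt_U d e : SU := proj (volt c d e).

Lemma voltC d e : volt c e d = volt c d e.
Proof.
rewrite /volt (wedge2DC (pt d)) (wedge2DC (fn d)) -scaleN1r opp1 // scale1r.
by rewrite -scaleN1r opp1 // scale1r.
Qed.

Lemma volt_U_sym d e : H3_adj d e -> volt_U e d = - volt_U d e.
Proof. by move=> _; rewrite SU_opp /volt_U voltC. Qed.

Lemma volt_U_triangle d e f : H3_adj d e -> H3_adj e f -> H3_adj d f ->
  volt_U d e + volt_U e f = volt_U d f.
Proof.
move=> /H3_adjE[de ed] /H3_adjE[ef fe] /H3_adjE[df fd].
apply/eqP; rewrite -subr_eq0 SU_opp -!projD; apply/eqP/proj_eq0; right.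
by apply: triangle_sum => //; apply: ev_fn_pt.
Qed.

Definition sqU (t : 'rV[F]_6) : SU := proj (sq t).

Lemma sqU_inj : injective sqU.
Proof.
move=> s t /eqP; rewrite -subr_eq0 SU_opp -projD -sqD => /eqP/proj_eq0/(sq_Uelt h2 hU) E.
by apply/eqP; rewrite -subr_eq0 -scaleN1r opp1 // scale1r E.
Qed.

(** On row vectors this is u -> f(u) v. *)
Definition projector d : 'M[F]_4 := tensor (fn d) (pt d).

Lemma mx_addrr (M : 'M[F]_4) : M + M = 0.
Proof. by apply/matrixP => i j; rewrite !mxE addrr2. Qed.

Lemma dart_law_volt d e : H3_adj d e ->
  dart_law c (projector d + projector e) 1 (volt c d e).
Proof.
move=> /H3_adjE[de ed] i k l kl.
by rewrite mulr1n; apply: sym_der => //; apply: ev_fn_pt.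
Qed.

Local Notation adjL := (lift_adj (@H3_adj F) volt_U).

(** Each inner vertex of the walk contributes its projector twice, so only the two ends remain; n
    counts the darts. *)
Lemma reach_dart_law p q : reach adjL p q -> exists n s,
  q.2 = p.2 + proj s /\ dart_law c (projector p.1 + projector q.1) n s.
Proof.
elim=> [u|u v r [uv Euv] _ [n [s [-> Hs]]]].
  by exists 0%N, 0; rewrite proj0 addr0 mx_addrr; split=> //; apply: dart_law0.
exists (1 + n)%N, (volt c u.1 v.1 + s); split.
  by rewrite projD -/(volt_U _ _) Euv SU_opp !addrA SU_addrr add0r.
have -> : projector u.1 + projector r.1 =
    (projector u.1 + projector v.1) + (projector v.1 + projector r.1).
  by rewrite addrA -(addrA (projector u.1)) mx_addrr addr0.
by apply: dart_lawD Hs; apply: dart_law_volt.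
Qed.

Lemma loop_in_squares d m n : reach adjL (d, m) (d, n) -> exists t, n = m + sqU t.
Proof.
move=> /reach_dart_law[k [s [/= -> Hs]]].
rewrite mx_addrr in Hs; have [t ->] := dart_law_closed h2 c0 hU Hs.
exists t; rewrite projD -/(sqU t); have U0 : proj (Uelt w x y z) = 0.
  by apply/proj_eq0; right.
suff -> : proj (Uelt w x y z *+ k) = 0 by rewrite addr0.
by elim: k {Hs} => [|k IH]; rewrite ?mulr0n ?proj0 // mulrS projD U0 IH addr0.
Qed.

Lemma pidx_rev (k : 'I_6) (p := pidx k) (q := pidx (rev_ord k)) :
  [&& p.1 != q.1, p.1 != q.2, p.2 != q.1, p.2 != q.2 & q.1 != q.2].
Proof.
rewrite /p /q !pidxE -!val_eqE.
by case: k p q => [[|[|[|[|[|[|//]]]]]] ?] ? ? /=; rewrite ?subSS ?subn0 /= !inordK.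
Qed.

Lemma ev_e4_e4 (i j : 'I_4) : ev (e4 F i) (e4 F j) = (i == j)%:R.
Proof. by rewrite ev_e4 mxE eqxx. Qed.

(* Fix two functionals e_a^*, e_b^* with {a, b} complementary to k: moving the
   points of the two vertices independently gives a quadrangle, and bilinearity of
   the voltage leaves a multiple of the square of the k-th basis vector of W. *)
Lemma loop_basis (k : 'I_6) (t : F) :
  loop (@H3_adj F) volt_U (sqU (t *: delta_mx 0 k)).
Proof.
have := pidx_rev k; set p := pidx k; set q := pidx (rev_ord k).
case/and5P => /negPf pq11 /negPf pq12 /negPf pq21 /negPf pq22 /negPf qq.
have qq' : (q.2 == q.1) = false by rewrite eq_sym.
have qp11 : (q.1 == p.1) = false by rewrite eq_sym.
have qp21 : (q.2 == p.1) = false by rewrite eq_sym.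
have qp12 : (q.1 == p.2) = false by rewrite eq_sym.
have qp22 : (q.2 == p.2) = false by rewrite eq_sym.
(* The factor c in c t cancels the c^-1 in [phi]. *)
pose v1 := e4 F q.1; pose v1' := v1 + (c * t) *: e4 F p.1.
pose v2 := e4 F q.2; pose v2' := v2 + e4 F p.2.
pose ee := (evDr, evZr, ev_e4_e4, eqxx, qq, qq', qp11, qp12, qp21, qp22, mulr0, addr0).
have E1 : ev (e4 F q.1) v1 = 1 by rewrite /v1 !ee.
have E1' : ev (e4 F q.1) v1' = 1 by rewrite /v1' /v1 !ee.
have E2 : ev (e4 F q.2) v2 = 1 by rewrite /v2 !ee.
have E2' : ev (e4 F q.2) v2' = 1 by rewrite /v2' /v2 !ee.
have A12 : H3_adj (antiflag E1) (antiflag E2).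
  by apply/adj_antiflag; rewrite /v1 /v2 !ee.
have A21' : H3_adj (antiflag E2) (antiflag E1').
  by apply/adj_antiflag; rewrite /v1' /v1 /v2 !ee.
have A1'2' : H3_adj (antiflag E1') (antiflag E2').
  by apply/adj_antiflag; rewrite /v1' /v2' /v1 /v2 !ee.
have A2'1 : H3_adj (antiflag E2') (antiflag E1).
  by apply/adj_antiflag; rewrite /v2' /v1 /v2 !ee.
have phi_dual : phi c (wedge2 (e4 F q.1) (e4 F q.2)) = c^-1 *: delta_mx 0 k.
  rewrite wedge2_basis (phiE h2) //; congr (_ *: _); apply/rowP => l; rewrite !mxE !eqxx.
  by rewrite (inj_eq rev_ord_inj).
have V : volt c (antiflag E1) (antiflag E2) + volt c (antiflag E2) (antiflag E1')
    + volt c (antiflag E1') (antiflag E2') + volt c (antiflag E2') (antiflag E1)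
    = sq (t *: delta_mx 0 k).
  rewrite (voltC (antiflag E1')) (voltC (antiflag E1)) !volt_antiflag phi_dual -!symDl.
  (* On expansion v1 /\ v2 occurs four times and each mixed term twice; only the product of the two
     displacements survives. *)
  have -> : wedge2 v1 v2 + wedge2 v1' v2 + wedge2 v1' v2' + wedge2 v1 v2'
      = (c * t) *: delta_mx 0 k.
    rewrite -(wedge2_basis F k) /v1' /v2' !(wedge2Dl, wedge2Dr, wedge2Zl).
    move: (wedge2 v1 v2) (wedge2 (e4 F p.1) v2) (wedge2 v1 _) (wedge2 _ _) => a1 a2 a3 a4.
    have four0 : 4 = 0 :> F by have -> : 4 = 2 * 2 :> F by [ring]; rewrite two0 ?mul0r.
    by apply/rowP => l; rewrite !mxE; ring: (two0 h2) four0.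
  rewrite symZl symZr; apply/ffunP => -[[i j] ij]; rewrite !ffunE /= !mxE.
  case: eqP => _; rewrite ?mulr1n ?mulr0n; last by ring: (two0 h2).
  by case: (i == k); rewrite /= ?mulr1n ?mulr0n; field.
have := loop_quadrangle (@H3_adj_sym F) volt_U_sym (@H3_connected F) A12 A21' A1'2' A2'1.
by rewrite SU_opp /volt_U -!projD V.
Qed.

Lemma loop_sqU t : loop (@H3_adj F) volt_U (sqU t).
Proof.
rewrite (row_sum_delta t) /sqU sq_sum.
elim/big_rec: _ => [|k s _ Hs]; first by rewrite proj0; apply: loop0.
by rewrite projD; apply: loopD Hs; apply: loop_basis.
Qed.

(** The neighbourhood determines the vertex of H_3, and any single neighbour then determines the
    group coordinate. *)
Lemma lift_reduced p q : nbhd_eq adjL p q -> p = q.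
Proof.
move=> N; have H u v : nbhd_eq adjL u v -> forall e, H3_adj u.1 e -> H3_adj v.1 e.
  move=> uv e ue; have := lift_adj_out volt_U u.2 ue.
  by rewrite -surjective_pairing => /uv[].
have E : p.1 = q.1.
  by apply: H3_nbhd_inj => e; split; apply: H => // r; rewrite N.
have [a [pa _]] := H3_common_nbr p.1 p.1.
have := lift_adj_out volt_U p.2 pa; rewrite -surjective_pairing => /N[_ /=].
rewrite E !SU_opp addrA -[LHS]add0r => /addIr/esym/eqP.
rewrite addr_eq0 SU_opp => /eqP E2.
by rewrite [p]surjective_pairing [q]surjective_pairing E E2.
Qed.

Definition Lt_proj (u : Lt_vtx h2 w x y z) : H3 * SU := (Ht_proj u.1, u.2).

Lemma Lt_adjE u v : Lt_adj c u v <-> adjL (Lt_proj u) (Lt_proj v).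
Proof.
by rewrite /Lt_adj /lift_adj /= /volt_U -voltageE; split=> -[/Ht_adjE].
Qed.

Lemma Gam_component_cover (C0 : Gam_vtx h2 c w x y z) :
  fold_cover (@comp_adj _ (@Gam_adj F h2 c w x y z) C0) (@H3_adj F) 'rV[F]_6.
Proof.
have q_surj p : exists u, Lt_proj u = p.
  by case: p => d m; have [a <-] := Ht_proj_surj d; exists (a, m).
(* The lift of H_3 has no twins, so the reduct merges exactly the fibres of [Lt_proj]. *)
have [r [r_inj r_surj rE]] := reduct_iso q_surj Lt_adjE lift_reduced.
apply: (lift_fold_cover (@H3_adj_sym F) volt_U_sym (@H3_connected F)
  volt_U_triangle r_inj r_surj rE sqU_inj loop_sqU loop_in_squares).
Qed.

End Assembly.

(* For every field F of characteristic 2, every choice of the isomorphism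
   chi : /\^4 V -> F (determined by c = chi(e0/\e1/\e2/\e3) <> 0), and
   any w, x, y, z with chi(w/\x/\y/\z) = 1 (defining U): every connected
   component of Gamma (the component of an arbitrary vertex C0) is an
   |F^6|-fold cover of H_3(F). *)
Theorem theorem3p6 (F : fieldType) (h2 : 2%N \in [pchar F]) (c : F)
  (hc : c != 0) (w x y z : 'rV[F]_4) (hU : chi c w x y z = 1)
  (C0 : Gam_vtx h2 c w x y z) :
  fold_cover (@comp_adj _ (@Gam_adj F h2 c w x y z) C0) (@H3_adj F)
    'rV[F]_6.
Proof. exact (Gam_component_cover hc hU C0). Qed.
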